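(* Let $\{x_k\}_{k=0}^{\infty}$ be a sequence generated by Algorithm 1 (described in the context) for the problem $\min \mathcal{V}(x)$ s.t. $x\in\Omega$, with $\psi(x_k,y_k)\neq 0$ for all $k$. Then every limit point of $\{x_k\}_{k=0}^{\infty}$ is a Pareto critical point of the problem $\min \mathcal{V}(x)$ s.t. $x\in\Omega$.
   Context: Setting. $m,n\ge 1$ are integers and $\Omega\subset\mathbb{R}^n$ is non-empty, compact and convex. For $i=1,\dots,m$: $f_i:\mathbb{R}^n\to\mathbb{R}$ is convex and continuously differentiable, and $\nabla f_i$ is $L_i$-Lipschitz continuous; $g_i:\mathbb{R}^n\to\mathbb{R}\cup\{+\infty\}$ is convex, proper, lower semicontinuous (not necessarily differentiable) and $L_{g_i}$-Lipschitz continuous on its domain $\mathrm{dom}(g_i)=\{x: g_i(x)<+\infty\}$. Put $\mathcal{F}=(f_1,\dots,f_m)$, $\mathcal{G}=(g_1,\dots,g_m)$, $\mathcal{D}=\mathrm{dom}(\mathcal{G})=\bigcap_{i=1}^m\mathrm{dom}(g_i)$, and assume $\Omega\subset\mathcal{D}$. Put $\mathcal{V}=\mathcal{F}+\mathcal{G}=(\mathcal{V}_1,\dots,\mathcal{V}_m)$ with $\mathcal{V}_i=f_i+g_i$, and $L=\max_i L_i$. $J\mathcal{F}(x)$ is the $m\times n$ Jacobian matrix with rows $\nabla f_i(x)^\top$. $e_m=(1,\dots,1)^\top\in\mathbb{R}^m$, and $\preceq$ is the componentwise order on $\mathbb{R}^m$. The multiobjective problem is $\min \mathcal{V}(x)$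 s.t. $x\in\Omega$. For $x,y\in\Omega$, $\psi(x,y)=\max_{i=1,\dots,m}\{\langle\nabla f_i(x),y-x\rangle+g_i(y)-g_i(x)\}$ and $\theta(x)=\min_{y\in\Omega}\psi(x,y)$. Pareto critical (stationary) point of the problem: a point $\bar x\in\mathrm{dom}(\mathcal{G})$ such that $\max_{i=1,\dots,m}\mathcal{V}_i'(\bar x;d)\ge 0$ for all $d\in\mathbb{R}^n$, where $\mathcal{V}_i'(x;d)=\lim_{t\downarrow 0}(\mathcal{V}_i(x+td)-\mathcal{V}_i(x))/t$. Algorithm 1. Fix real numbers $0<\sigma_{\min}\le 1$, $\alpha_{\min}>0$, $0<2\varepsilon_0<L$, $0<\beta<\frac12$, a point $x_0\in\Omega$, and real sequences $\{\sigma_k\},\{\alpha_k\}$ with $\sigma_{\min}\le\sigma_k\le 1$ and $\alpha_{\min}\le\alpha_k$ for all $k$. For $k=0,1,2,\dots$: Step 1: choose $y_k\in\Omega$ with $\psi(x_k,y_k)\le\max\{\sigma_k\theta(x_k),-\alpha_k\}$; if $\psi(x_k,y_k)=0$ stop. Step 2: let $d_k=y_k-x_k$ if $\psi(x_k,y_k)\le-\varepsilon_k\|y_k-x_k\|^2$, and otherwise $d_k=\frac{t_k(y_k-x_k)}{\varepsilon_k\|y_k-x_k\|^2}$, where $t_k=|\psi(x_k,y_k)|$. Step 3: let $l_k$ be the smallest positive integer $j$ such that $\mathcal{V}(x_k+(1-2\beta)^jd_k)-\mathcal{V}(x_k)\preceq(1-2\beta)^j\beta\big(J\mathcal{F}(x_k)d_k+\mathcal{G}(x_k+d_k)-\mathcal{G}(x_k)-\varepsilon_k\|d_k\|^2e_m\big)$,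 and set $\lambda_k=(1-2\beta)^{l_k}$. Step 4: set $x_{k+1}=x_k+\lambda_kd_k$ and $\varepsilon_{k+1}=\varepsilon_k(1-2\beta)^{1-l_k}$.
   Formalization: Pareto criticality is taken for the constrained problem: V_i is set to +∞ off Ω, so only feasible directions matter. With all d in R^n and V_i itself the claim fails (f(x)=x²/2+x, g=0, Ω=[0,1], limit point 0, d=-1). *)

(* Defs.v *)
(* MathComp-Analysis; R is an abstract realType and R^n is 'rV[R]_n. *)
From HB Require Import structures.
From mathcomp Require Import all_boot all_order all_algebra.
From mathcomp Require Import all_classical all_reals all_analysis.
Set Implicit Arguments.
Unset Strict Implicit.
Unset Printing Implicit Defensive.
Import Order.TTheory GRing.Theory Num.Theory numFieldNormedType.Exports.
Local Open Scope classical_set_scope.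
Local Open Scope ring_scope.

Definition dot {R : realType} {n : nat} (u v : 'rV[R]_n) : R :=
  \sum_(j < n) u 0 j * v 0 j.

(* The library norm on 'rV[R]_n is the sup norm; it induces the same topology
   but gives different Lipschitz constants and a different step rule. *)
Definition enorm {R : realType} {n : nat} (u : 'rV[R]_n) : R :=
  Num.sqrt (dot u u).

Definition grad {R : realType} {n : nat} (f : 'rV[R]_n -> R) (x : 'rV[R]_n) :
    'rV[R]_n :=
  \row_(j < n) 'D_(delta_mx 0 j) f x.

Definition jac {R : realType} {m n : nat} (f : 'I_m -> 'rV[R]_n -> R)
    (x : 'rV[R]_n) : 'M[R]_(m, n) :=
  \matrix_(i < m, j < n) grad (f i) x 0 j.

Definition continuously_differentiable {R : realType} {n : nat}
    (f : 'rV[R]_n -> R) : Prop :=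
  (forall x, differentiable f x) /\ continuous (grad f).

Definition grad_lipschitz {R : realType} {n : nat} (L : R)
    (f : 'rV[R]_n -> R) : Prop :=
  forall x y, enorm (grad f x - grad f y) <= L * enorm (x - y).

(* Lipschitz constants on R^n with 0 < n are nonnegative, so that starting the
   maximum at 0 does not change it. *)
Definition max_lip {R : realType} {m : nat} (L : 'I_m -> R) : R :=
  \big[Num.max/0]_(i < m) L i.

Definition dom {R : realType} {n : nat} (g : 'rV[R]_n -> \bar R) :
    set 'rV[R]_n :=
  [set x | (g x < +oo)%E].

Definition domG {R : realType} {m n : nat} (g : 'I_m -> 'rV[R]_n -> \bar R) :
    set 'rV[R]_n :=
  \bigcap_(i in [set: 'I_m]) dom (g i).

(* Properness includes that the value -oo is never taken. *)
Definition proper_efun {R : realType} {n : nat} (g : 'rV[R]_n -> \bar R) :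
    Prop :=
  (forall x, g x != -oo%E) /\ dom g !=set0.

(* Meaningful for functions that never take the value -oo. *)
Definition convex_efun {R : realType} {n : nat} (g : 'rV[R]_n -> \bar R) :
    Prop :=
  forall (x y : 'rV[R]_n) (t : R), 0 < t -> t < 1 ->
    (g (t *: x + (1 - t) *: y)%R <= t%:E * g x + (1 - t)%:E * g y)%E.

Definition lipschitz_on_dom {R : realType} {n : nat} (L : R)
    (g : 'rV[R]_n -> \bar R) : Prop :=
  forall x y, dom g x -> dom g y ->
    `|fine (g x) - fine (g y)| <= L * enorm (x - y).

Definition objective {R : realType} {m n : nat} (f : 'I_m -> 'rV[R]_n -> R)
    (g : 'I_m -> 'rV[R]_n -> \bar R) (i : 'I_m) (x : 'rV[R]_n) : \bar R :=
  ((f i x)%:E + g i x)%E.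

(* On Omega (contained in domG g) every term is finite; -oo is only the unit of
   the maximum, which is over a non-empty index set when 0 < m. *)
Definition psi {R : realType} {m n : nat} (f : 'I_m -> 'rV[R]_n -> R)
    (g : 'I_m -> 'rV[R]_n -> \bar R) (x y : 'rV[R]_n) : \bar R :=
  (\big[maxe/-oo]_(i < m) ((dot (grad (f i) x) (y - x)%R)%:E + (g i y - g i x)))%E.

(* The infimum is attained: Omega is compact and psi x is lower semicontinuous. *)
Definition theta {R : realType} {m n : nat} (f : 'I_m -> 'rV[R]_n -> R)
    (g : 'I_m -> 'rV[R]_n -> \bar R) (Omega : set 'rV[R]_n) (x : 'rV[R]_n) :
    \bar R :=
  ereal_inf [set psi f g x y | y in Omega].

Definition diff_quot {R : realType} {n : nat} (V : 'rV[R]_n -> \bar R)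
    (x d : 'rV[R]_n) (t : R) : \bar R :=
  ((V (x + t *: d)%R - V x) * (t^-1)%:E)%E.

Definition dirderiv {R : realType} {n : nat} (V : 'rV[R]_n -> \bar R)
    (x d : 'rV[R]_n) : \bar R :=
  lim (diff_quot V x d t @[t --> 0^'+]).

(* [lim] is a junk value on divergent filters, hence the explicit existence of
   the one-sided limits in \bar R. *)
Definition pareto_critical {R : realType} {m n : nat}
    (V : 'I_m -> 'rV[R]_n -> \bar R) (x : 'rV[R]_n) : Prop :=
  (forall i, dom (V i) x) /\
  forall d : 'rV[R]_n,
    (forall i, cvg (diff_quot (V i) x d t @[t --> 0^'+])) /\
    (0 <= \big[maxe/-oo]_(i < m) dirderiv (V i) x d)%E.

(* The problem "min V s.t. x in Omega": the objectives are +oo off Omega, so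
   that the directional derivatives along infeasible directions are +oo.
   Ignoring Omega here would require more than constrained criticality: for
   V x = x on Omega = [0, 1], the minimizer 0 has V'(0; -1) = -1 < 0. *)
Definition constrained {R : realType} {m n : nat} (Omega : set 'rV[R]_n)
    (V : 'I_m -> 'rV[R]_n -> \bar R) (i : 'I_m) (x : 'rV[R]_n) : \bar R :=
  if x \in Omega then V i x else +oo%E.

Definition sufficient_decrease {R : realType} {m n : nat}
    (f : 'I_m -> 'rV[R]_n -> R) (g : 'I_m -> 'rV[R]_n -> \bar R)
    (beta eps : R) (x d : 'rV[R]_n) (j : nat) : Prop :=
  forall i : 'I_m,
    (objective f g i (x + (1 - 2 * beta) ^+ j *: d)%R - objective f g i x <=
     ((1 - 2 * beta) ^+ j * beta)%:E *
       (((jac f x *m d^T) i 0)%:E + (g i (x + d)%R - g i x)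
        - (eps * enorm d ^+ 2)%:E))%E.

(* An infinite run: the stopping test of step 1 never succeeds. *)
Record infinite_run {R : realType} {m n : nat}
    (f : 'I_m -> 'rV[R]_n -> R) (g : 'I_m -> 'rV[R]_n -> \bar R)
    (Omega : set 'rV[R]_n) (beta : R) (sigma alpha : nat -> R)
    (x y d : nat -> 'rV[R]_n) (eps lambda : nat -> R) (l : nat -> nat) : Prop :=
  InfiniteRun {
    run_start : Omega (x 0%N);
    run_y : forall k, Omega (y k) /\
      (psi f g (x k) (y k) <=
       maxe ((sigma k)%:E * theta f g Omega (x k)) (- alpha k)%:E)%E;
    run_nostop : forall k, psi f g (x k) (y k) != 0%E;
    run_d : forall k, d k =
      if (psi f g (x k) (y k) <= (- (eps k * enorm (y k - x k) ^+ 2))%:E)%E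
      then y k - x k
      else (`|fine (psi f g (x k) (y k))| / (eps k * enorm (y k - x k) ^+ 2))
             *: (y k - x k);
    run_l : forall k, (0 < l k)%N /\
      sufficient_decrease f g beta (eps k) (x k) (d k) (l k) /\
      forall j : nat, (0 < j < l k)%N ->
        ~ sufficient_decrease f g beta (eps k) (x k) (d k) j;
    run_lambda : forall k, lambda k = (1 - 2 * beta) ^+ l k;
    run_x : forall k, x k.+1 = x k + lambda k *: d k;
    run_eps : forall k, eps k.+1 = eps k * (1 - 2 * beta) ^ (1 - (l k)%:Z)
  }.

(* Main.v *)
Require Import Defs.
From HB Require Import structures.
From mathcomp Require Import all_boot all_order all_algebra.
From mathcomp Require Import all_classical all_reals all_analysis.
From mathcomp Require Import ring lra.
Set Implicit Arguments.
Unset Strict Implicit.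
Unset Printing Implicit Defensive.
Import Order.TTheory GRing.Theory Num.Theory numFieldNormedType.Exports.
Local Open Scope classical_set_scope.
Local Open Scope ring_scope.

(** Write delta = 1 - 2 beta and t_k = - psi (x_k, y_k), and let s_k be the
    factor with d_k = s_k (y_k - x_k); the two cases of the step rule are
    s_k = min (1, t_k / (eps_k |y_k - x_k|^2)) in disguise, so that s_k <= 1
    and eps_k |d_k|^2 <= s_k t_k ([step_scale]).  In particular all iterates
    stay in Omega, by convexity.

    The proof rests on the fact that eps_k cannot grow beyond L / (2 delta).
    Indeed the linearized variation of every objective along d_k is at most
    - s_k t_k <= - eps_k |d_k|^2, and the descent lemma for Lipschitz gradients
    then shows that the line search accepts every exponent j with
    delta^j L <= 2 delta eps_k ([small_step_accepted]).  Hence if l_k > 1, the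
    rejection of l_k - 1 shows that
    eps_k / delta^(l_k - 1) < L / (2 delta), and the left-hand side is
    eps_(k+1) ([eps_le]).  As delta^(l_k - 1) = eps_k / eps_(k+1), a bounded
    and nondecreasing eps gives a positive lower bound on the step lengths
    lambda_k ([lambda_ge]).

    Consequently each objective decreases at step k by at least a fixed multiple
    of s_k t_k ([value_decrease]); being bounded below on the compact set Omega,
    it forces s_k t_k --> 0.  Since eps_k and the diameter of Omega are bounded,
    s_k >= min (1, const * t_k), so that t_k --> 0 ([gap_vanishes]).

    If some z in Omega had psi (xbar, z) < 0 at a limit point xbar, then
    psi (x_k, z) would stay below a negative constant for infinitely many k,
    so theta (x_k) too, and the choice of y_k would keep t_k away from 0
    ([gap_lower_bound], [cluster_slope]).  Hence psi (xbar, z) >= 0 on Omega.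
    Along a feasible direction the difference quotients of each g_i are monotone
    and bounded, hence converge, and psi (xbar, xbar + t d) >= 0 for small t
    passes to the limit; along an infeasible direction they are +oo
    ([critical_of_slopes]). *)

(** * Inner product and descent lemma *)

Lemma dotC (R : realType) (n : nat) (u v : 'rV[R]_n) : dot u v = dot v u.
Proof. by apply: eq_bigr => j _; rewrite mulrC. Qed.

Lemma dotDl (R : realType) (n : nat) (u v w : 'rV[R]_n) :
  dot (u + v) w = dot u w + dot v w.
Proof. by rewrite -big_split; apply: eq_bigr => j _; rewrite mxE mulrDl. Qed.

Lemma dotZl (R : realType) (n : nat) (a : R) (u w : 'rV[R]_n) :
  dot (a *: u) w = a * dot u w.
Proof. by rewrite mulr_sumr; apply: eq_bigr => j _; rewrite mxE mulrA. Qed.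

Lemma dotDr (R : realType) (n : nat) (u v w : 'rV[R]_n) :
  dot w (u + v) = dot w u + dot w v.
Proof. by rewrite !(dotC w) dotDl. Qed.

Lemma dotZr (R : realType) (n : nat) (a : R) (u w : 'rV[R]_n) :
  dot w (a *: u) = a * dot w u.
Proof. by rewrite !(dotC w) dotZl. Qed.

Lemma dotBl (R : realType) (n : nat) (u v w : 'rV[R]_n) :
  dot (u - v) w = dot u w - dot v w.
Proof. by rewrite dotDl -scaleN1r dotZl mulN1r. Qed.

Lemma dotBr (R : realType) (n : nat) (u v w : 'rV[R]_n) :
  dot w (u - v) = dot w u - dot w v.
Proof. by rewrite !(dotC w) dotBl. Qed.

Lemma dot_ge0 (R : realType) (n : nat) (u : 'rV[R]_n) : 0 <= dot u u.
Proof. by apply: sumr_ge0 => j _; rewrite -expr2 sqr_ge0. Qed.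

Lemma enorm_sqr (R : realType) (n : nat) (u : 'rV[R]_n) :
  enorm u ^+ 2 = dot u u.
Proof. by rewrite sqr_sqrtr ?dot_ge0. Qed.

Lemma enorm_ge0 (R : realType) (n : nat) (u : 'rV[R]_n) : 0 <= enorm u.
Proof. exact: sqrtr_ge0. Qed.

(** This is |u - c v|^2 >= 0.  When |u| <= c |v| it yields <u, v> <= c |v|^2,
    the form in which the descent lemma uses a Lipschitz bound c. *)
Lemma dot_young (R : realType) (n : nat) (c : R) (u v : 'rV[R]_n) :
  2 * c * dot u v <= dot u u + c ^+ 2 * dot v v.
Proof.
have := dot_ge0 (u - c *: v).
by rewrite dotBl !dotBr !dotZl !dotZr (dotC v u); lra.
Qed.

Lemma dot_continuous (R : realType) (n : nat) (T : topologicalType)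
    (u v : T -> 'rV[R]_n) (x : T) :
  {for x, continuous u} -> {for x, continuous v} ->
  {for x, continuous (fun z => dot (u z) (v z))}.
Proof.
move=> cu cv; rewrite /prop_for /continuous_at /dot.
apply: (cvg_big (op := +%R)) => [|j _]; first exact: add_continuous.
apply: cvgM.
  exact: (continuous_comp cu (@coord_continuous _ _ _ _ _ _)).
exact: (continuous_comp cv (@coord_continuous _ _ _ _ _ _)).
Qed.

Lemma enorm_continuous (R : realType) (n : nat) :
  continuous (@enorm R n).
Proof.
move=> u; apply: continuous_comp; last exact: sqrt_continuous.
by apply: dot_continuous; exact: cvg_id.
Qed.

Lemma enorm0 (R : realType) (n : nat) : enorm (0 : 'rV[R]_n) = 0.
Proof.
by rewrite /enorm /dot big1 ?sqrtr0// => j _; rewrite mxE mul0r.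
Qed.

Lemma sub_continuous (R : realType) (n : nat) (w : 'rV[R]_n) :
  continuous (fun z : 'rV[R]_n => w - z).
Proof.
move=> z.
have cw : {for z, continuous (fun _ : 'rV[R]_n => w)} by exact: cst_continuous.
have cz : {for z, continuous (fun u : 'rV[R]_n => u)} by exact: cvg_id.
exact: (continuousB cw cz).
Qed.

(** Such functions serve as continuous substitutes for the g_i, which may jump
    to +oo at the boundary of their domain. *)
Lemma lip_bound_continuous (R : realType) (n : nat) (L : R) (w : 'rV[R]_n) :
  continuous (fun z : 'rV[R]_n => L * enorm (w - z)).
Proof.
move=> z.
have cL : {for z, continuous (fun _ : 'rV[R]_n => L)} by exact: cst_continuous.
have ce : {for z, continuous (fun u : 'rV[R]_n => enorm (w - u))}.
  apply: (continuous_comp (@sub_continuous _ _ w z)).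
  exact: enorm_continuous.
exact: (continuousM cL ce).
Qed.

(** [grad] collects partial derivatives only; differentiability makes the
    derivative linear in the direction, hence equal to their combination. *)
Lemma derive_dot_grad (R : realType) (n : nat) (f : 'rV[R]_n -> R)
    (a v : 'rV[R]_n) :
  differentiable f a -> 'D_v f a = dot (grad f a) v.
Proof.
move=> df; rewrite deriveE// [in LHS](row_sum_delta v) linear_sum.
by apply: eq_bigr => j _; rewrite linearZ mxE deriveE// mulrC.
Qed.

Lemma is_derive_line (R : realType) (n : nat) (f : 'rV[R]_n -> R)
    (a v : 'rV[R]_n) (t : R) :
  differentiable f (a + t *: v) ->
  is_derive t 1 (fun s : R => f (a + s *: v)) (dot (grad f (a + t *: v)) v).
Proof.
move=> df; rewrite -derive_dot_grad//.
have E : (fun h : R => h^-1 *: (((fun s : R => f (a + s *: v)) \o shift t) (h *: 1)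
    - f (a + t *: v))) =
  (fun h : R => h^-1 *: ((f \o shift (a + t *: v)) (h *: v) - f (a + t *: v))).
  apply/funext => h /=; congr (_ *: (f _ - _)).
  by rewrite scalerDl /GRing.scale /= mulr1 addrCA.
split; first by rewrite /derivable E; exact: diff_derivable.
by rewrite /derive E.
Qed.

(** The function t |-> f (a + t v) - t <grad f a, v> - t^2 (L / 2) |v|^2 has
    derivative <grad f (a + t v) - grad f a, v> - t L |v|^2 <= 0 on [0, 1]. *)
Lemma descent (R : realType) (n : nat) (f : 'rV[R]_n -> R) (L : R)
    (a v : 'rV[R]_n) :
  0 < L -> (forall x, differentiable f x) -> grad_lipschitz L f ->
  f (a + v) - f a <= dot (grad f a) v + L / 2 * dot v v.
Proof.
move=> L0 df lip.
pose phi (t : R) := f (a + t *: v) - (t * dot (grad f a) v + t ^+ 2 * (L / 2 * dot v v)).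
have dphi (t : R) : is_derive t 1 phi
    (dot (grad f (a + t *: v)) v - (dot (grad f a) v + t * L * dot v v)).
  have := @is_derive_line _ _ f a v t (df _) => dl.
  rewrite /phi; apply: is_deriveB.
  have -> : (fun t0 : R => t0 * dot (grad f a) v + t0 ^+ 2 * (L / 2 * dot v v)) =
    (fun t0 : R => dot (grad f a) v *: t0 + (L / 2 * dot v v) *: t0 ^+ 2).
    by apply/funext => s; rewrite /GRing.scale /= mulrC [X in _ + X]mulrC.
  apply: is_derive_eq.
  by rewrite /GRing.scale /=; field.
have phi_le : phi 1 <= phi 0.
  apply: (@ler0_derive1_le _ phi 0 1 _ _ true false); rewrite ?in_itv/= ?lexx ?ler01//.
  - move=> t /=; rewrite in_itv/= => /andP[t0 _]; rewrite derive1E derive_val.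
    set w := grad f (a + t *: v) - grad f a.
    have -> : dot (grad f (a + t *: v)) v = dot w v + dot (grad f a) v.
      by rewrite dotBl subrK.
    have c0 : 0 < t * L by rewrite mulr_gt0.
    have ww : dot w w <= (t * L) ^+ 2 * dot v v.
      have := lip (a + t *: v) a; rewrite -/w addrAC subrr add0r => lw.
      rewrite -enorm_sqr (le_trans (lerXn2r 2 _ _ lw)) ?nnegrE ?enorm_ge0//.
        by rewrite mulr_ge0 ?enorm_ge0// ltW.
      by rewrite exprMn enorm_sqr dotZl dotZr; lra.
    suff: dot w v <= t * L * dot v v by lra.
    rewrite -(ler_pM2l c0); have := dot_young (t * L) w v; lra.
  - by apply: derivable_within_continuous => t _; exact: ex_derive.
move: phi_le; rewrite /phi !scale1r scale0r addr0; lra.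
Qed.

(** * Convexity along segments *)

Lemma proper_fine (R : realType) (n : nat) (g : 'rV[R]_n -> \bar R)
    (x : 'rV[R]_n) :
  proper_efun g -> dom g x -> g x = (fine (g x))%:E.
Proof.
move=> [gN _] gx; rewrite fineK// fin_numE gN/=.
by apply/eqP => gxy; move: gx; rewrite /dom /= gxy.
Qed.

Lemma convex_segment (R : realType) (n : nat) (g : 'rV[R]_n -> \bar R)
    (x y : 'rV[R]_n) (t : R) :
  proper_efun g -> convex_efun g -> dom g x -> dom g y -> 0 < t -> t <= 1 ->
  fine (g (x + t *: (y - x))) - fine (g x) <= t * (fine (g y) - fine (g x)).
Proof.
move=> gp gc gx gy t0; rewrite le_eqVlt => /predU1P[->|t1].
  by rewrite scale1r subrKC mul1r.
have := gc y x t t0 t1.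
have -> : t *: y + (1 - t) *: x = x + t *: (y - x).
  by rewrite scalerBl scale1r scalerBr addrCA.
rewrite (proper_fine gp gx) (proper_fine gp gy) -!EFinM -EFinD => le_g.
have dz : dom g (x + t *: (y - x)) by exact: le_lt_trans le_g (ltry _).
by move: le_g; rewrite (proper_fine gp dz) lee_fin /=; lra.
Qed.

Lemma convex_set_segment (R : realType) (n : nat) (A : set 'rV[R]_n)
    (x y : 'rV[R]_n) (t : R) :
  convex_set A -> A x -> A y -> 0 <= t -> t <= 1 -> A (x + t *: (y - x)).
Proof.
move=> Ac Ax Ay t0 t1.
have := Ac y x (Itv01 t0 t1); rewrite !inE => /(_ Ay Ax).
congr A; rewrite /conv /= /isConvexSpace.conv /= /unstable.onem.
by rewrite scalerBl scale1r scalerBr addrCA.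
Qed.

(** * Finite forms of the extended-valued quantities *)

(** The i-th term of the maximum psi (x, y), in R: it is meaningful when x and
    y lie in the domain of g_i. *)
Definition slope (R : realType) (m n : nat) (f : 'I_m -> 'rV[R]_n -> R)
    (g : 'I_m -> 'rV[R]_n -> \bar R) (x y : 'rV[R]_n) (i : 'I_m) : R :=
  dot (grad (f i) x) (y - x) + (fine (g i y) - fine (g i x)).

Definition value (R : realType) (m n : nat) (f : 'I_m -> 'rV[R]_n -> R)
    (g : 'I_m -> 'rV[R]_n -> \bar R) (i : 'I_m) (x : 'rV[R]_n) : R :=
  f i x + fine (g i x).

Section RealForms.
Context (R : realType) (m n : nat) (f : 'I_m -> 'rV[R]_n -> R).
Context (g : 'I_m -> 'rV[R]_n -> \bar R).
Hypothesis g_proper : forall i, proper_efun (g i).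

Lemma domG_fine i x : domG g x -> g i x = (fine (g i x))%:E.
Proof. by move=> gx; apply: proper_fine => //; exact: gx. Qed.

Lemma objectiveE i x : domG g x -> objective f g i x = (value f g i x)%:E.
Proof. by move=> gx; rewrite /objective (domG_fine i gx). Qed.

Lemma psiE x y : domG g x -> domG g y ->
  psi f g x y = (\big[maxe/-oo]_(i < m) (slope f g x y i)%:E)%E.
Proof.
move=> gx gy; apply: eq_bigr => i _.
by rewrite (domG_fine i gx) (domG_fine i gy) -EFinB -EFinD.
Qed.

Lemma psi_leP x y c : domG g x -> domG g y ->
  (psi f g x y <= c%:E)%E <-> forall i, slope f g x y i <= c.
Proof.
move=> gx gy; rewrite psiE//; split.
  by move=> /bigmax_leP[_ le_c] i; rewrite -lee_fin; exact: le_c.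
by move=> le_c; apply/bigmax_leP; split=> [|i _]; rewrite ?leNye// lee_fin.
Qed.

Lemma psi_ltP x y c : domG g x -> domG g y ->
  (psi f g x y < c%:E)%E <-> forall i, slope f g x y i < c.
Proof.
move=> gx gy; rewrite psiE//; split.
  by move=> /bigmax_ltP[_ lt_c] i; rewrite -lte_fin; exact: lt_c.
by move=> lt_c; apply/bigmax_ltP; split=> [|i _]; rewrite ?ltNye// lte_fin.
Qed.

(** The hypothesis on m excludes the empty maximum, which is -oo. *)
Lemma psi_fine x y : (0 < m)%N -> domG g x -> domG g y ->
  psi f g x y = (fine (psi f g x y))%:E.
Proof.
move=> m0 gx gy; rewrite fineK// fin_numElt; apply/andP; split.
  rewrite psiE//; apply/bigmax_gtP; right.
  by exists (Ordinal m0) => //; rewrite ltNye.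
apply: le_lt_trans (ltry (\sum_i `|slope f g x y i|)).
apply/psi_leP => // i; apply: (le_trans (ler_norm _)).
by rewrite (bigD1 i)//= lerDl sumr_ge0.
Qed.

Lemma psi_xx x : (0 < m)%N -> domG g x -> psi f g x x = 0%E.
Proof.
move=> m0 gx; have s0 i : slope f g x x i = 0.
  by rewrite /slope !subrr addr0 -(scale0r (0 : 'rV[R]_n)) dotZr mul0r.
apply/eqP; rewrite eq_le; apply/andP; split.
  by apply/psi_leP => // i; rewrite s0.
rewrite leNgt; apply/negP => /(psi_ltP 0 gx gx)/(_ (Ordinal m0)).
by rewrite s0 ltxx.
Qed.

(** The slope vanishes at y = x and is convex in y. *)
Lemma slope_segment x y t i :
  (forall j, convex_efun (g j)) -> domG g x -> domG g y -> 0 < t -> t <= 1 ->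
  slope f g x (x + t *: (y - x)) i <= t * slope f g x y i.
Proof.
move=> gc gx gy t0 t1.
have le_g := convex_segment (g_proper i) (gc i) (gx i I) (gy i I) t0 t1.
by rewrite /slope addrAC subrr add0r dotZr mulrDr lerD2l.
Qed.

Lemma sufficient_decreaseP beta eps x d j :
  domG g x -> domG g (x + d) -> domG g (x + (1 - 2 * beta) ^+ j *: d) ->
  sufficient_decrease f g beta eps x d j <->
  forall i, value f g i (x + (1 - 2 * beta) ^+ j *: d) - value f g i x <=
    (1 - 2 * beta) ^+ j * beta * (slope f g x (x + d) i - eps * dot d d).
Proof.
move=> gx gd gj.
suff E i : (objective f g i (x + (1 - 2 * beta) ^+ j *: d)%R - objective f g i x <=
     ((1 - 2 * beta) ^+ j * beta)%:E *
       (((jac f x *m d^T) i 0)%:E + (g i (x + d)%R - g i x)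
        - (eps * enorm d ^+ 2)%:E))%E =
  (value f g i (x + (1 - 2 * beta) ^+ j *: d) - value f g i x <=
    (1 - 2 * beta) ^+ j * beta * (slope f g x (x + d) i - eps * dot d d)).
  by split=> H i; have := H i; rewrite E.
rewrite !objectiveE// (domG_fine i gx) (domG_fine i gd) enorm_sqr.
rewrite -!EFinB -EFinM lee_fin /slope [x + d - x]addrAC subrr add0r.
suff -> : (jac f x *m d^T) i 0 = dot (grad (f i) x) d by [].
by rewrite mxE; apply: eq_bigr => k _; rewrite !mxE.
Qed.

End RealForms.

(** * The run of the algorithm *)

(** The sequence V converges, so its decrements tend to 0. *)
Lemma vanishing_decrease (R : realType) (V a : nat -> R) (M c e : R) :
  0 < c -> 0 < e -> (forall k, 0 <= a k) -> (forall k, M <= V k) ->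
  (forall k, V k.+1 <= V k - c * a k) -> \forall k \near \oo, a k < e.
Proof.
move=> c0 e0 a0 MV dec.
have cvgV : cvgn V.
  apply: nonincreasing_is_cvgn.
    apply/nonincreasing_seqP => k; apply: (le_trans (dec k)).
    by rewrite gerBl mulr_ge0// ltW.
  by exists M => _ [k _ <-].
have drop0 : (V k - V k.+1) @[k --> \oo] --> (0 : R).
  rewrite -(subrr (limn V)); apply: cvgB => //.
  by rewrite (cvg_shiftS V).
near=> k; rewrite -(ltr_pM2l c0).
have : V k - V k.+1 < c * e.
  by near: k; exact: (cvgr_lt _ drop0 _ (mulr_gt0 c0 e0)).
by have := dec k; lra.
Unshelve. all: by end_near.
Qed.

(** Both branches of the step rule are scalings of v = y - x by some s in
    (0, 1].  In the second branch s is chosen so that eps |s v|^2 = s t with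
    t = - p.  When v = 0 the test of the first branch reads p <= 0 and
    succeeds, so no division by zero occurs. *)
Lemma step_scale (R : realType) (n : nat) (p eps : R) (v d : 'rV[R]_n) : p < 0 ->
  d = (if p <= - (eps * enorm v ^+ 2) then v
       else (`|p| / (eps * enorm v ^+ 2)) *: v) ->
  exists s, [/\ 0 < s <= 1, d = s *: v, eps * dot d d <= s * - p &
    s = 1 \/ s * (eps * dot v v) = - p].
Proof.
move=> p0; rewrite enorm_sqr; case: ifPn => [le_p ->|].
  exists 1; rewrite ltr01 lexx scale1r mul1r; split=> //; last by left.
  by rewrite lerNr.
rewrite -ltNge => lt_p ->; rewrite ltr0_norm//.
have N0 : 0 < eps * dot v v by lra.
exists (- p / (eps * dot v v)); split=> //.
- by rewrite divr_gt0 ?oppr_gt0//= ler_pdivrMr// mul1r lerNl ltW.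
- rewrite dotZl dotZr le_eqVlt; apply/orP; left; apply/eqP; field.
  by apply/andP; split; apply/eqP => E0; move: N0; rewrite E0 ?mulr0 ?mul0r ltxx.
- by right; rewrite divfK// gt_eqF.
Qed.

Section Run.
Context (R : realType) (m n : nat) (m_gt0 : (0 < m)%N).
Context (Omega : set 'rV[R]_n) (f : 'I_m -> 'rV[R]_n -> R).
Context (g : 'I_m -> 'rV[R]_n -> \bar R).
Context (L sigma_min alpha_min beta : R) (sigma alpha : nat -> R).
Context (x y d : nat -> 'rV[R]_n) (eps lambda : nat -> R) (l : nat -> nat).
Hypothesis Omega_convex : convex_set Omega.
Hypothesis f_diff : forall i z, differentiable (f i) z.
Hypothesis f_lip : forall i, grad_lipschitz L (f i).
Hypothesis g_proper : forall i, proper_efun (g i).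
Hypothesis g_convex : forall i, convex_efun (g i).
Hypothesis Omega_dom : Omega `<=` domG g.
Hypothesis sigma_min_gt0 : 0 < sigma_min.
Hypothesis alpha_min_gt0 : 0 < alpha_min.
Hypothesis beta_bounds : 0 < beta < 2^-1.
Hypothesis sigma_ge : forall k, sigma_min <= sigma k.
Hypothesis alpha_ge : forall k, alpha_min <= alpha k.
Hypothesis eps0_bounds : 0 < 2 * eps 0%N < L.
Hypothesis run : infinite_run f g Omega beta sigma alpha x y d eps lambda l.

Let delta : R := 1 - 2 * beta.
(** The number t_k of the step rule, positive along the run. *)
Let gap (k : nat) : R := - fine (psi f g (x k) (y k)).

Let delta_gt0 : 0 < delta.
Proof. by rewrite /delta; move: beta_bounds => /andP[_]; lra. Qed.

Let delta_lt1 : delta < 1.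
Proof. by rewrite /delta; move: beta_bounds => /andP[]; lra. Qed.

Let L_gt0 : 0 < L.
Proof. by move: eps0_bounds => /andP[]; lra. Qed.

(** The update of eps undoes all but one of the contractions of the line
    search; written without inverses. *)
Lemma eps_step k : eps k.+1 * delta ^+ (l k).-1 = eps k.
Proof.
have [l0 _] := run_l run k.
rewrite (run_eps run) -/delta -[in X in X * _](prednK l0) intS opprD addrA subrr.
by rewrite add0r -exprnN mulfVK// expf_neq0// gt_eqF.
Qed.

Lemma eps_gt0 k : 0 < eps k.
Proof.
elim: k => [|k IH]; first by move: eps0_bounds => /andP[]; lra.
by move: IH; rewrite -[eps k]eps_step pmulr_lgt0// exprn_gt0.
Qed.

Lemma eps_ge_eps0 k : eps 0%N <= eps k.
Proof.
elim: k => // k /le_trans; apply; rewrite -[leLHS]eps_step.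
by rewrite ler_piMr ?exprn_ile1// ltW// eps_gt0.
Qed.

Lemma lambda_itv k : 0 < lambda k <= 1.
Proof.
by rewrite (run_lambda run) -/delta exprn_gt0//= exprn_ile1// ltW.
Qed.

(** theta (x_k) <= psi (x_k, x_k) = 0 makes psi (x_k, y_k) nonpositive, and the
    stopping test excludes 0. *)
Lemma psi_run k : Omega (x k) ->
  psi f g (x k) (y k) = (- gap k)%:E /\ 0 < gap k.
Proof.
move=> xO; have [yO le_psi] := run_y run k.
have psi_r := psi_fine f g_proper m_gt0 (Omega_dom xO) (Omega_dom yO).
split; first by rewrite /gap opprK -psi_r.
rewrite oppr_gt0 lt_neqAle -lee_fin -psi_r; apply/andP; split.
  by apply: contra_neq (run_nostop run k) => E0; rewrite psi_r E0.
apply: (le_trans le_psi); rewrite ge_max; apply/andP; split; last first.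
  by rewrite lee_fin oppr_le0 (le_trans (ltW alpha_min_gt0)).
apply: mule_ge0_le0; first by rewrite lee_fin (le_trans (ltW sigma_min_gt0)).
apply: ereal_inf_lbound; exists (x k) => //.
by rewrite psi_xx//; exact: Omega_dom.
Qed.

Lemma run_step k : Omega (x k) ->
  exists s, [/\ 0 < s <= 1, d k = s *: (y k - x k),
    eps k * dot (d k) (d k) <= s * gap k &
    s = 1 \/ s * (eps k * dot (y k - x k) (y k - x k)) = gap k].
Proof.
move=> xO; have [psi_r gap0] := psi_run xO.
have := @step_scale _ _ (- gap k) (eps k) (y k - x k) (d k).
rewrite oppr_lt0 gap0 opprK; apply=> //.
by rewrite (run_d run) psi_r lee_fin.
Qed.

Lemma run_segment k t : Omega (x k) -> 0 <= t -> t <= 1 ->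
  Omega (x k + t *: d k).
Proof.
move=> xO t0 t1; have [s [/andP[s0 s1] -> _ _]] := run_step xO.
rewrite scalerA; apply: convex_set_segment => //.
- by have [] := run_y run k.
- by rewrite mulr_ge0// ltW.
- by rewrite mulr_ile1// ltW.
Qed.

Lemma run_in_Omega k : Omega (x k).
Proof.
elim: k => [|k IH]; first exact: run_start run.
have /andP[l0 l1] := lambda_itv k.
by rewrite (run_x run); apply: run_segment => //; exact: ltW.
Qed.

Lemma run_slope k s i : 0 < s <= 1 -> d k = s *: (y k - x k) ->
  slope f g (x k) (x k + d k) i <= - (s * gap k).
Proof.
move=> /andP[s0 s1] ->; have xO := run_in_Omega k.
have [yO _] := run_y run k; have [psi_r gap0] := psi_run xO.
have xg := Omega_dom xO; have yg := Omega_dom yO.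
apply: (le_trans (slope_segment f g_proper i g_convex xg yg s0 s1)).
rewrite -mulrN ler_pM2l//.
by apply: (proj1 (psi_leP f g_proper _ xg yg)); rewrite psi_r.
Qed.

Lemma run_decreaseP k j :
  sufficient_decrease f g beta (eps k) (x k) (d k) j <->
  forall i, value f g i (x k + delta ^+ j *: d k) - value f g i (x k) <=
    delta ^+ j * beta *
      (slope f g (x k) (x k + d k) i - eps k * dot (d k) (d k)).
Proof.
have xO := run_in_Omega k.
apply: sufficient_decreaseP => //; first exact: Omega_dom.
  by apply: Omega_dom; rewrite -[d k]scale1r; apply: run_segment.
apply: Omega_dom; apply: run_segment => //; first by rewrite exprn_ge0// ltW.
by rewrite exprn_ile1// ltW.
Qed.

(** With A the slope along d_k, the descent lemma and convexity bound the
    variation at step mu by mu A + (L / 2) mu^2 |d_k|^2.  Since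
    A <= - eps_k |d_k|^2, subtracting the required mu beta (A - eps_k |d_k|^2)
    leaves a linear part mu ((1 - beta) A + beta eps_k |d_k|^2), at most
    - mu delta eps_k |d_k|^2, which absorbs the quadratic term. *)
Lemma small_step_accepted k j :
  (0 < j)%N -> delta ^+ j * L <= 2 * delta * eps k ->
  sufficient_decrease f g beta (eps k) (x k) (d k) j.
Proof.
move=> j0 small; apply/run_decreaseP => i; have xO := run_in_Omega k.
have [s [s_itv dE eps_d _]] := run_step xO.
have := run_slope i s_itv dE; set A := slope _ _ _ _ _ => leA.
set mu := delta ^+ j in small *.
have mu0 : 0 < mu by rewrite exprn_gt0.
have mu1 : mu <= 1 by rewrite exprn_ile1// ltW.
have dO : Omega (x k + d k) by rewrite -[d k]scale1r; apply: run_segment.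
have := descent (x k) (mu *: d k) L_gt0 (f_diff i) (f_lip i).
rewrite dotZl !dotZr => le_f.
have xg := Omega_dom xO; have dg := Omega_dom dO.
have := convex_segment (g_proper i) (g_convex i) (xg i I) (dg i I) mu0 mu1.
rewrite [x k + d k - x k]addrAC subrr add0r => le_g.
have le_V : value f g i (x k + mu *: d k) - value f g i (x k) <=
    mu * A + L / 2 * (mu * (mu * dot (d k) (d k))).
  by rewrite /A /slope /value [x k + d k - x k]addrAC subrr add0r; lra.
apply: (le_trans le_V).
have le_mu : L * mu * dot (d k) (d k) <= 2 * delta * eps k * dot (d k) (d k).
  by rewrite ler_wpM2r ?dot_ge0// mulrC.
have A1 : (1 - beta) * A <= (1 - beta) * - (eps k * dot (d k) (d k)).
  by rewrite ler_pM2l; [lra | move: beta_bounds => /andP[_]; lra].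
rewrite -subr_ge0.
have -> : mu * beta * (A - eps k * dot (d k) (d k)) -
    (mu * A + L / 2 * (mu * (mu * dot (d k) (d k)))) =
  mu * (- ((1 - beta) * A) - beta * (eps k * dot (d k) (d k)) -
    (L * mu * dot (d k) (d k)) / 2) by field.
apply: mulr_ge0; first exact: ltW.
by move: le_mu A1; rewrite /delta; lra.
Qed.

(** Either l_k = 1 and eps is unchanged, or the exponent l_k - 1 >= 1 was
    rejected although it would be small enough to be accepted if eps_(k+1)
    exceeded the bound. *)
Lemma eps_le k : eps k <= L / (2 * delta).
Proof.
have d2 : 0 < 2 * delta by rewrite mulr_gt0.
elim: k => [|k IH]; rewrite ler_pdivlMr//.
  have /andP[/ltW e0 /ltW] := eps0_bounds; apply: le_trans.
  by rewrite mulrA [eps 0%N * 2]mulrC ler_piMr// ltW.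
have [l0 [_ minl]] := run_l run k.
have := eps_step k; case: (ltnP 1 (l k)) => l1; last first.
  have -> : l k = 1%N by apply/eqP; rewrite eqn_leq l1.
  by rewrite expr0 mulr1 => ->; rewrite -ler_pdivlMr.
move=> E; rewrite leNgt; apply/negP => big.
have j0 : (0 < (l k).-1)%N by rewrite -ltnS prednK.
apply: (minl (l k).-1); first by rewrite j0/= prednK.
apply: small_step_accepted => //.
have dj : 0 < delta ^+ (l k).-1 by rewrite exprn_gt0.
rewrite -E mulrC.
have -> : 2 * delta * (eps k.+1 * delta ^+ (l k).-1) =
  eps k.+1 * (2 * delta) * delta ^+ (l k).-1 by ring.
by rewrite ler_pM2r// ltW.
Qed.

Let cstep : R := delta * eps 0%N / (L / (2 * delta)).

Let cstep_gt0 : 0 < cstep.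
Proof. by rewrite !(divr_gt0, mulr_gt0)// eps_gt0. Qed.

(** lambda_k = delta * delta^(l_k - 1) = delta * eps_k / eps_(k+1), where
    eps_k >= eps_0 and eps_(k+1) <= L / (2 delta). *)
Lemma lambda_ge k : cstep <= lambda k.
Proof.
have [l0 _] := run_l run k.
have E0 : 0 < L / (2 * delta) by rewrite divr_gt0// mulr_gt0.
rewrite (run_lambda run) -/delta -(prednK l0) exprS /cstep -mulrA.
rewrite ler_pM2l// ler_pdivrMr// mulrC.
apply: (le_trans (eps_ge_eps0 k)); rewrite -[eps k]eps_step.
by rewrite ler_pM2r ?eps_le// exprn_gt0.
Qed.

Lemma value_decrease k i s : 0 < s <= 1 -> d k = s *: (y k - x k) ->
  value f g i (x k.+1) <= value f g i (x k) - cstep * beta * (s * gap k).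
Proof.
move=> s_itv dE; have [_ [/run_decreaseP/(_ i) dec _]] := run_l run k.
have leA := run_slope i s_itv dE; have [_ gap0] := psi_run (run_in_Omega k).
move: dec; rewrite -[delta ^+ l k](run_lambda run) -(run_x run) => dec.
have b0 : 0 < beta by case/andP: beta_bounds.
have ed : 0 <= eps k * dot (d k) (d k) by rewrite mulr_ge0 ?dot_ge0// ltW ?eps_gt0.
have lb : 0 < lambda k * beta by rewrite mulr_gt0//; case/andP: (lambda_itv k).
have H1 : lambda k * beta * (slope f g (x k) (x k + d k) i - eps k * dot (d k) (d k))
    <= lambda k * beta * - (s * gap k) by rewrite ler_pM2l//; lra.
have H2 : cstep * beta * (s * gap k) <= lambda k * beta * (s * gap k).
  rewrite ler_pM2r ?ler_pM2r ?lambda_ge//.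
  by rewrite mulr_gt0//; case/andP: s_itv.
by move: dec H1 H2; lra.
Qed.

Context (Lg : 'I_m -> R).
Hypothesis Omega_compact : compact Omega.
Hypothesis grad_cont : forall i, continuous (grad (f i)).
Hypothesis g_lip : forall i, lipschitz_on_dom (Lg i) (g i).

Let Omega_neq0 : Omega !=set0.
Proof. by exists (x 0%N); exact: run_in_Omega. Qed.

Lemma value_bounded_below i : exists M, forall z, Omega z -> M <= value f g i z.
Proof.
have x0O := run_in_Omega 0; set w := x 0 in x0O.
pose h z := f i z - Lg i * enorm (w - z).
have h_cont : {within Omega, continuous h}.
  apply: continuous_subspaceT => z.
  have fc : {for z, continuous (f i)} by exact: differentiable_continuous.
  have ec : {for z, continuous (fun u : 'rV[R]_n => Lg i * enorm (w - u))}.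
    exact: lip_bound_continuous.
  exact: (continuousB fc ec).
have [c _ min_c] := EVT_min_rV Omega_neq0 Omega_compact h_cont.
exists (h c + fine (g i w)) => z zO.
have wg := Omega_dom x0O; have zg := Omega_dom zO.
have := min_c z (mem_set zO); have := g_lip (wg i I) (zg i I).
by rewrite ler_norml /h /value => /andP[]; lra.
Qed.

(** By the parallelogram identity, |u - v|^2 is bounded by distances to one
    fixed point, to which the extreme value theorem applies. *)
Lemma Omega_diameter : exists2 D, 0 < D & forall u v, Omega u -> Omega v ->
  dot (u - v) (u - v) <= D.
Proof.
pose w := x 0; pose h (z : 'rV[R]_n) := dot (w - z) (w - z).
have h_cont : {within Omega, continuous h}.
  apply: continuous_subspaceT => z.
  exact: (dot_continuous (@sub_continuous _ _ w z) (@sub_continuous _ _ w z)).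
have [c _ max_c] := EVT_max_rV Omega_neq0 Omega_compact h_cont.
(* The summand 1 only makes the bound positive when Omega is a point. *)
exists (4 * h c + 1) => [|u v uO vO]; first by have := dot_ge0 (w - c); rewrite /h; lra.
have := dot_ge0 ((w - u) + (w - v)).
have -> : u - v = (w - v) - (w - u) by rewrite opprB [RHS]addrC addrA subrK.
have := max_c u (mem_set uO); have := max_c v (mem_set vO); rewrite /h.
move: (w - u) (w - v) => a b.
by rewrite !dotBl !dotBr !dotDl !dotDr; lra.
Qed.

(** A gap at least e at step k would give s_k t_k >= min (e, e^2 / K), with K a
    bound on eps_k |y_k - x_k|^2, against the vanishing of s_k t_k. *)
Lemma gap_vanishes e : 0 < e -> \forall k \near \oo, gap k < e.
Proof.
move=> e0; have [M MV] := value_bounded_below (Ordinal m_gt0).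
have [D D0 diam] := Omega_diameter.
have /choice[s sP] : forall k, exists s, _ := fun k => run_step (run_in_Omega k).
have gap0 k : 0 < gap k by have [] := psi_run (run_in_Omega k).
pose K := L / (2 * delta) * D.
have K0 : 0 < K by rewrite mulr_gt0// divr_gt0// mulr_gt0.
have b0 : 0 < beta by case/andP: beta_bounds.
have c0 : 0 < Num.min e (e ^+ 2 / K) by rewrite lt_min e0 divr_gt0// exprn_gt0.
have small : \forall k \near \oo, s k * gap k < Num.min e (e ^+ 2 / K).
  apply: (@vanishing_decrease _ (fun k => value f g (Ordinal m_gt0) (x k)) _ M
    (cstep * beta)) => // [|k|k|k].
  - exact: mulr_gt0.
  - by have [/andP[/ltW s0 _] _ _ _] := sP k; rewrite mulr_ge0// ltW.
  - exact/MV/run_in_Omega.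
  - by have [sk dk _ _] := sP k; exact: value_decrease.
near=> k; rewrite ltNge; apply/negP => gap_e.
have : s k * gap k < Num.min e (e ^+ 2 / K) by near: k.
apply/negP; rewrite -leNgt ge_min; apply/orP.
have [/andP[s0 _] _ _ [->|sE]] := sP k; first by left; rewrite mul1r.
right; rewrite ler_pdivrMr//.
have gapK : gap k <= s k * K.
  rewrite -sE ler_pM2l//; apply: ler_pM; rewrite ?dot_ge0 ?eps_le//.
    exact/ltW/eps_gt0.
  by apply: diam; [have [] := run_y run k | exact: run_in_Omega].
rewrite mulrAC expr2; apply: ler_pM => //; [exact: ltW|exact: ltW|].
exact: le_trans gapK.
Unshelve. all: by end_near.
Qed.

(** Inexactness of the choice of y_k costs at most the factor sigma_min and the
    cap alpha_min: a uniform descent -c at one point z of Omega is seen by y_k. *)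
Lemma gap_lower_bound k z c : Omega z -> 0 < c ->
  (forall i, slope f g (x k) z i < - c) ->
  Num.min (sigma_min * c) alpha_min <= gap k.
Proof.
move=> zO c0 lt_c; have xO := run_in_Omega k.
have xg := Omega_dom xO; have zg := Omega_dom zO.
have [psi_r _] := psi_run xO; have [_] := run_y run k; rewrite psi_r => le_max.
suff : ((- gap k)%:E <= (- Num.min (sigma_min * c) alpha_min)%:E)%E.
  by rewrite lee_fin lerN2.
apply: (le_trans le_max); rewrite ge_max; apply/andP; split; last first.
  by rewrite lee_fin lerN2 ge_min alpha_ge orbT.
have theta_c : (theta f g Omega (x k) <= (- c)%:E)%E.
  apply: (@le_trans _ _ (psi f g (x k) z)); last first.
    by apply/ltW/(psi_ltP f g_proper _ xg zg).
  by apply: ereal_inf_lbound; exists z.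
have sk0 : 0 < sigma k by apply: lt_le_trans (sigma_ge k).
apply: (@le_trans _ _ ((sigma k)%:E * (- c)%:E)%E).
  by apply: lee_wpmul2l => //; rewrite lee_fin ltW.
rewrite -EFinM lee_fin mulrN lerN2 ge_min; apply/orP; left.
by rewrite ler_pM2r.
Qed.

(** By the Lipschitz bound on g_i, slope (w, z) is at most a function that is
    continuous in w and agrees with it at w = xbar; negativity of all slopes at xbar then persists,
    uniformly in i, at iterates of arbitrarily large index. *)
Lemma cluster_slope xbar z : cluster (x @ \oo) xbar -> Omega xbar -> Omega z ->
  exists i, 0 <= slope f g xbar z i.
Proof.
move=> x_xbar bO zO; apply/not_existsP => neg.
have bg := Omega_dom bO; have zg := Omega_dom zO.
pose p := fine (psi f g xbar z).
have psi_p : psi f g xbar z = p%:E by exact: psi_fine.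
have p0 : p < 0.
  rewrite -lte_fin -psi_p; apply/(psi_ltP f g_proper _ bg zg) => i.
  by rewrite ltNge; apply/negP.
have le_p i : slope f g xbar z i <= p.
  by move: i; apply/(psi_leP f g_proper _ bg zg); rewrite psi_p.
pose h i w := dot (grad (f i) w) (z - w) + (fine (g i z) - fine (g i xbar))
  + Lg i * enorm (xbar - w).
have h_cont i : {for xbar, continuous (h i)}.
  have fc : {for xbar, continuous (fun w : 'rV[R]_n => dot (grad (f i) w) (z - w))}.
    exact: (dot_continuous (@grad_cont i xbar) (@sub_continuous _ _ z xbar)).
  have ec : {for xbar, continuous (fun w : 'rV[R]_n => Lg i * enorm (xbar - w))}.
    exact: lip_bound_continuous.
  by apply: (continuousD _ ec); apply: (continuousD fc); exact: cst_continuous.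
have near_h i : \forall w \near xbar, h i w < p / 2.
  apply: (cvgr_lt _ (h_cont i)); rewrite /h subrr enorm0 mulr0 addr0.
  by apply: le_lt_trans (le_p i) _; lra.
have all_h : \forall w \near xbar, forall i, h i w < p / 2.
  exact: (@filter_forall _ _ (fun i w => h i w < p / 2) (nbhs xbar) _ near_h).
have c0 : 0 < Num.min (sigma_min * (- (p / 2))) alpha_min.
  by rewrite lt_min alpha_min_gt0 andbT mulr_gt0//; lra.
have far : (x @ \oo) (x @` [set k | gap k < Num.min (sigma_min * (- (p / 2))) alpha_min]).
  by apply: (@filterS _ \oo _ _ _ _ (gap_vanishes c0)) => k gk; exists k.
have [_ [[k gk <-] hk]] := x_xbar _ _ far all_h.
move: gk => /=; apply/negP; rewrite -leNgt.
apply: (gap_lower_bound zO) => [|i]; first by lra.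
rewrite opprK; apply: le_lt_trans (hk i).
have kg := Omega_dom (run_in_Omega k).
have := g_lip (bg i I) (kg i I).
by rewrite ler_norml /h /slope => /andP[_]; lra.
Qed.

End Run.

(** * Criticality from nonnegative slopes *)

Section Criticality.
Context (R : realType) (m n : nat) (m_gt0 : (0 < m)%N).
Context (Omega : set 'rV[R]_n) (f : 'I_m -> 'rV[R]_n -> R).
Context (g : 'I_m -> 'rV[R]_n -> \bar R) (Lg : 'I_m -> R).
Hypothesis Omega_convex : convex_set Omega.
Hypothesis f_diff : forall i z, differentiable (f i) z.
Hypothesis g_proper : forall i, proper_efun (g i).
Hypothesis g_convex : forall i, convex_efun (g i).
Hypothesis g_lip : forall i, lipschitz_on_dom (Lg i) (g i).
Hypothesis Omega_dom : Omega `<=` domG g.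

Lemma diff_quot_feasible i x d t : Omega x -> Omega (x + t *: d) ->
  diff_quot (constrained Omega (objective f g) i) x d t =
  ((value f g i (x + t *: d) - value f g i x) / t)%:E.
Proof.
move=> xO zO; rewrite /diff_quot /constrained !mem_set//.
have xg := Omega_dom xO; have zg := Omega_dom zO.
by rewrite (objectiveE f g_proper i zg) (objectiveE f g_proper i xg) -EFinB -EFinM.
Qed.

Lemma diff_quot_infeasible i x d t : Omega x -> 0 < t -> ~ Omega (x + t *: d) ->
  diff_quot (constrained Omega (objective f g) i) x d t = +oo%E.
Proof.
move=> xO t0 zO; rewrite /diff_quot /constrained [x \in _]mem_set// memNset//.
rewrite (objectiveE f g_proper i (Omega_dom xO)) addye//.
by rewrite gt0_mulye// lte_fin invr_gt0.
Qed.

Lemma feasible_shorter x d s t : Omega x -> Omega (x + t *: d) ->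
  0 < s -> s <= t -> Omega (x + s *: d).
Proof.
move=> xO zO s0 st; have t0 := lt_le_trans s0 st.
have := @convex_set_segment _ _ _ x (x + t *: d) (s / t) Omega_convex xO zO.
rewrite [x + t *: d - x]addrAC subrr add0r scalerA divfK ?gt_eqF//; apply.
  by rewrite divr_ge0// ltW.
by rewrite ler_pdivrMr// mul1r.
Qed.

(** Difference quotients of a convex function are nondecreasing in t, and the
    Lipschitz constant bounds them below. *)
Lemma g_quot_cvg i x d t0 : 0 < t0 -> Omega x -> Omega (x + t0 *: d) ->
  cvg ((fine (g i (x + t *: d)) - fine (g i x)) / t @[t --> 0^'+]).
Proof.
move=> t00 xO z0O; have xg := Omega_dom xO.
have feas s : 0 < s -> s <= t0 -> domG g (x + s *: d).
  by move=> s0 st; apply/Omega_dom/(feasible_shorter xO z0O).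
apply: nondecreasing_at_right_is_cvgr.
  near=> b => s t; rewrite !in_itv/= => /andP[s0 sb] /andP[tt0 tb] st.
  have bt0 : b < t0 by near: b; exact: nbhs_right_lt.
  have tg := feas t tt0 (ltW (lt_trans tb bt0)).
  have st0 : 0 < s / t by rewrite divr_gt0.
  have st1 : s / t <= 1 by rewrite ler_pdivrMr// mul1r.
  have := convex_segment (g_proper i) (g_convex i) (xg i I) (tg i I) st0 st1.
  rewrite [x + t *: d - x]addrAC subrr add0r scalerA divfK ?gt_eqF// => le_g.
  rewrite ler_pdivrMr//; apply: (le_trans le_g).
  by rewrite le_eqVlt; apply/orP; left; apply/eqP; ring.
near=> b; exists (- (Lg i * enorm d)) => _ [t /= + <-].
rewrite in_itv/= => /andP[tt0 tb].
have bt0 : b < t0 by near: b; exact: nbhs_right_lt.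
have tg := feas t tt0 (ltW (lt_trans tb bt0)).
have := g_lip (tg i I) (xg i I).
have -> : enorm (x + t *: d - x) = t * enorm d.
  rewrite addrAC subrr add0r /enorm dotZl dotZr mulrA -expr2 sqrtrM ?sqr_ge0//.
  by rewrite sqrtr_sqr gtr0_norm.
by rewrite ler_norml => /andP[le_g _]; rewrite ler_pdivlMr//; lra.
Unshelve. all: by end_near.
Qed.

(** In a feasible direction the i-th directional derivative is the limit of
    q_i (t) = slope (x, x + t d) / t; if all these limits were negative, all
    slopes towards one x + t d in Omega would be negative.  By convexity a
    direction is either feasible for all small t > 0 or for no t > 0. *)
Lemma critical_of_slopes x : Omega x ->
  (forall z, Omega z -> exists i, 0 <= slope f g x z i) ->
  pareto_critical (constrained Omega (objective f g)) x.
Proof.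
move=> xO psi_ge0; have xg := Omega_dom xO; split=> [i|d].
  by rewrite /dom /constrained /= mem_set// (objectiveE f g_proper i xg) ltry.
have [[t0 t00 z0O]|infeas] := pselect (exists2 t, 0 < t & Omega (x + t *: d)).
  pose q i t : R := dot (grad (f i) x) d + (fine (g i (x + t *: d)) - fine (g i x)) / t.
  have feas : \forall t \near 0^'+, 0 < t /\ Omega (x + t *: d).
    near=> t; have tt0 : 0 < t by near: t; exact: nbhs_right_gt.
    split=> //; apply: (feasible_shorter xO z0O) => //.
    by near: t; exact: nbhs_right_le.
  have q_cvg i : cvg (q i t @[t --> 0^'+]).
    by apply: is_cvgD; [exact: is_cvg_cst | exact: g_quot_cvg z0O].
  have dq_cvg i : diff_quot (constrained Omega (objective f g) i) x d t @[t --> 0^'+] -->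
      (lim (q i t @[t --> 0^'+]))%:E.
    have f_cvg : (f i (x + t *: d) - f i x) / t @[t --> 0^'+] --> dot (grad (f i) x) d.
      have := @is_derive_line _ _ (f i) x d 0 (f_diff i _).
      rewrite scale0r addr0 => -[dv <-].
      apply: cvg_dnbhs_at_right; move: dv; rewrite /derivable /derive => dv.
      apply: cvg_trans dv; apply: near_eq_cvg; near=> h.
      by rewrite /= scale0r !addr0 /GRing.scale /= mulr1 mulrC.
    have : (f i (x + t *: d) - f i x) / t + (fine (g i (x + t *: d)) - fine (g i x)) / t
        @[t --> 0^'+] --> lim (q i t @[t --> 0^'+]).
      rewrite /q limD; [|exact: is_cvg_cst | exact: g_quot_cvg z0O].
      by rewrite lim_cst//; apply: cvgD => //; exact: g_quot_cvg z0O.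
    move=> V_cvg; apply: cvg_EFin.
      near=> t; have [tt0 zO] : 0 < t /\ Omega (x + t *: d) by near: t.
      by rewrite diff_quot_feasible.
    apply: cvg_trans V_cvg; apply: near_eq_cvg; near=> t.
    have [tt0 zO] : 0 < t /\ Omega (x + t *: d) by near: t.
    by rewrite /= diff_quot_feasible// /value -mulrDl /=; congr (_ / _); ring.
  split=> [i|]; first by apply/cvg_ex; eexists; exact: dq_cvg.
  rewrite leNgt; apply/negP => /bigmax_ltP[_ lt0].
  have q_lt0 i : \forall t \near 0^'+, q i t < 0.
    apply: (cvgr_lt _ (q_cvg i)); rewrite -lte_fin -(cvg_lim _ (dq_cvg i)) //.
    exact: lt0.
  have q_all : \forall t \near 0^'+, forall i, q i t < 0 by exact: filter_forall.
  have [t [[tt0 zO] qt]] := @filter_ex _ (0^'+) _ _ (filterI feas q_all).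
  have [i] := psi_ge0 _ zO.
  rewrite leNgt => /negP; apply.
  rewrite /slope [x + t *: d - x]addrAC subrr add0r dotZr.
  have := qt i; rewrite /q -(ltr_pM2l tt0) mulr0 mulrDr.
  by rewrite [t * (_ / _)]mulrC divfK ?gt_eqF.
have dq_cvg i : diff_quot (constrained Omega (objective f g) i) x d t @[t --> 0^'+] --> +oo%E.
  apply: cvg_near_cst; near=> t.
  have tt0 : 0 < t by near: t; exact: nbhs_right_gt.
  by rewrite diff_quot_infeasible// => zO; apply: infeas; exists t.
split=> [i|]; first by apply/cvg_ex; eexists; exact: dq_cvg.
apply: (bigmax_sup (Ordinal m_gt0)) => //.
by rewrite /dirderiv (cvg_lim _ (dq_cvg _))//.
Unshelve. all: by end_near.
Qed.

End Criticality.

(** * Limit points of the run *)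

Theorem theorem1 (R : realType) (m n : nat) (hm : (0 < m)%N) (hn : (0 < n)%N)
    (Omega : set 'rV[R]_n)
    (Omega_nonempty : Omega !=set0)
    (Omega_compact : compact Omega)
    (Omega_convex : convex_set Omega)
    (f : 'I_m -> 'rV[R]_n -> R) (g : 'I_m -> 'rV[R]_n -> \bar R)
    (Lf Lg : 'I_m -> R)
    (f_convex : forall i, convex_function setT (f i))
    (f_C1 : forall i, continuously_differentiable (f i))
    (f_grad_lipschitz : forall i, grad_lipschitz (Lf i) (f i))
    (g_proper : forall i, proper_efun (g i))
    (g_convex : forall i, convex_efun (g i))
    (g_lsc : forall i, lower_semicontinuous (g i))
    (g_lipschitz : forall i, lipschitz_on_dom (Lg i) (g i))
    (Omega_dom : Omega `<=` domG g)
    (sigma_min alpha_min beta : R) (sigma alpha : nat -> R)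
    (sigma_min_bounds : 0 < sigma_min <= 1)
    (alpha_min_pos : 0 < alpha_min)
    (beta_bounds : 0 < beta < 2^-1)
    (sigma_bounds : forall k, sigma_min <= sigma k <= 1)
    (alpha_bound : forall k, alpha_min <= alpha k)
    (x y d : nat -> 'rV[R]_n) (eps lambda : nat -> R) (l : nat -> nat)
    (eps0_bounds : 0 < 2 * eps 0%N < max_lip Lf)
    (run : infinite_run f g Omega beta sigma alpha x y d eps lambda l) :
  forall xbar : 'rV[R]_n, cluster (x @ \oo) xbar ->
    pareto_critical (constrained Omega (objective f g)) xbar.
Proof.
move=> xbar x_xbar.
have L_lip i : grad_lipschitz (max_lip Lf) (f i).
  move=> u v; apply: (le_trans (f_grad_lipschitz i u v)).
  by rewrite ler_wpM2r ?enorm_ge0// le_bigmax.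
have f_diff i z : differentiable (f i) z by have [df _] := f_C1 i; exact: df.
have grad_cont i : continuous (grad (f i)) by have [_] := f_C1 i.
have sigma_min_gt0 : 0 < sigma_min by case/andP: sigma_min_bounds.
have sigma_ge k : sigma_min <= sigma k by case/andP: (sigma_bounds k).
have x_in := run_in_Omega hm Omega_convex g_proper Omega_dom sigma_min_gt0
  alpha_min_pos beta_bounds sigma_ge alpha_bound run.
have bO : Omega xbar.
  apply: (compact_closed (@norm_hausdorff _ _) Omega_compact) => B xB.
  have x_Omega : (x @ \oo) Omega by apply: (@filterE _ \oo) => k; exact: x_in.
  by have [z []] := x_xbar _ _ x_Omega xB; exists z.
apply: (critical_of_slopes hm Omega_convex f_diff g_proper g_convex g_lipschitz
  Omega_dom bO) => z zO.
exact: (cluster_slope hm Omega_convex f_diff L_lip g_proper g_convex Omega_dom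
  sigma_min_gt0 alpha_min_pos beta_bounds sigma_ge alpha_bound eps0_bounds run
  Omega_compact grad_cont g_lipschitz x_xbar bO zO).
Qed.
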